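(* Let $\mathcal{C}$ be an $(n,k)$ MDS code over a finite field. Then the treewidth $\kappa(\mathcal{C})$ and the trelliswidth $\tau(\mathcal{C})$ satisfy $$\kappa(\mathcal{C}) = \tau(\mathcal{C}) = \min\{k,\,n-k+1\}.$$
   Context: An $(n,k)$ linear code is a linear code $\mathcal{C}$ of length $n$ and dimension $k$ over a finite field $\mathbb{F}_q$, with coordinates indexed by a set $I$ of size $n$. It is MDS if it is nonzero and its minimum distance equals $n-k+1$. For $J\subseteq I$, the shortening $\mathcal{C}_J$ is the code obtained by restricting to the coordinates in $J$ those codewords $c\in\mathcal{C}$ with $c_i=0$ for all $i\notin J$ (so $\mathcal{C}_\emptyset$ has dimension $0$). A tree is a connected graph with no cycles. A tree decomposition of $\mathcal{C}$ is a pair $(T,\omega)$ where $T$ is a (finite) tree and $\omega: I\to V(T)$ is any map. For a node $v$ of $T$, let $E(v)$ be the set of edges incident with $v$; for $e\in E(v)$ let $T_{e,v}$ be the component of $T-e$ not containing $v$, and let $I_{e,v}=\omega^{-1}(V(T_{e,v}))$. Put $$\kappa_v = k-\sum_{e\in E(v)}\dim(\mathcal{C}_{I_{e,v}}),\qquad \kappa(\mathcal{C};T,\omega)=\max_{v\in V(T)}\kappa_v .$$ The treewidth of $\mathcal{C}$ is $\kappa(\mathcal{C})=\min_{(T,\omega)}\kappa(\mathcal{C};T,\omega)$, the minimum being over all tree decompositions of $\mathcal{C}$. The trelliswidth of $\mathcal{C}$ is $\tau(\mathcal{C})=\min_{\pi}\kappa(\mathcal{C};P,\pi)$, where $P$ is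 the path on $n$ nodes and the minimum is over all bijections $\pi: I\to V(P)$. *)

(* Defs.v *)
From HB Require Import structures.
From mathcomp Require Import all_boot all_order all_algebra.

Set Implicit Arguments.
Unset Strict Implicit.
Unset Printing Implicit Defensive.

Import Order.TTheory GRing.Theory Num.Theory.
Local Open Scope ring_scope.

(* Minima and maxima are taken over families that are not a priori finite
   (all trees) or carry no default value, so "the minimum (maximum) of S is m"
   is a relation; by antisymmetry it determines m. *)
Definition is_least d (T : porderType d) (S : T -> Prop) (m : T) : Prop :=
  S m /\ forall x, S x -> (m <= x)%O.

Definition is_greatest d (T : porderType d) (S : T -> Prop) (m : T) : Prop :=
  S m /\ forall x, S x -> (x <= m)%O.

Lemma is_least_uniq d (T : porderType d) (S : T -> Prop) (m m' : T) :
  is_least S m -> is_least S m' -> m = m'.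
Proof. by move=> [Sm lem] [Sm' lem']; apply: le_anti; rewrite lem ?lem'. Qed.

Lemma is_greatest_uniq d (T : porderType d) (S : T -> Prop) (m m' : T) :
  is_greatest S m -> is_greatest S m' -> m = m'.
Proof. by move=> [Sm lem] [Sm' lem']; apply: le_anti; rewrite lem ?lem'. Qed.

Section Codes.
Variables (F : finFieldType) (I : finType).
Implicit Types (C : {vspace {ffun I -> F^o}}) (J : {set I}).

Definition hamming_dist (x y : {ffun I -> F^o}) : nat :=
  #|[set i | x i != y i]|.

Definition is_min_dist C (d : nat) : Prop :=
  is_least (fun d' : nat => exists x y,
    [/\ x \in C, y \in C, x != y & hamming_dist x y = d']) d.

(* The subtraction is exact, since \dim C <= #|I|. *)
Definition is_MDS C : Prop :=
  C != 0%VS /\ is_min_dist C (#|I| - \dim C + 1)%N.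

Definition restr J (x : {ffun I -> F^o}) : {ffun {i : I | i \in J} -> F^o} :=
  [ffun i => x (val i)].

Fact restr_is_linear J : linear (restr J).
Proof. by move=> a x y; apply/ffunP=> i; rewrite !ffunE. Qed.

HB.instance Definition _ J :=
  GRing.isLinear.Build F {ffun I -> F^o} {ffun {i : I | i \in J} -> F^o}
    _ (restr J) (restr_is_linear J).

Definition shortening C J : {vspace {ffun {i : I | i \in J} -> F^o}} :=
  (linfun (restr J) @: (C :&: lker (linfun (restr (~: J)))))%VS.

Lemma shorteningP C J (y : {ffun {i : I | i \in J} -> F^o}) :
  reflect (exists x, [/\ x \in C, forall i, i \notin J -> x i = 0
                       & y = restr J x])
          (y \in shortening C J).
Proof.
apply: (iffP memv_imgP) => [[x] | [x [xC x0 ->]]].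
  rewrite memv_cap memv_ker lfunE => /andP[xC /eqP/ffunP x0] ->.
  exists x; split; rewrite ?lfunE // => i iJ.
  have iJC : i \in ~: J by rewrite inE.
  by have := x0 (exist _ i iJC); rewrite !ffunE.
exists x; rewrite ?lfunE // memv_cap xC memv_ker lfunE.
apply/eqP/ffunP => i; rewrite !ffunE; apply: x0.
by have := valP i; rewrite inE.
Qed.

End Codes.

Section Trees.
Variables (V : finType) (E : rel V).

Definition is_tree : Prop :=
  [/\ symmetric E, irreflexive E, (0 < #|V|)%N,
      forall x y, connect E x y
    & forall c : seq V, (2 < size c)%N -> ~ ucycle E c].

Definition incident_edges (v : V) : {set {set V}} :=
  [set [set v; u] | u in V & E v u].

Definition delete_edge (e : {set V}) : rel V :=
  [rel x y | E x y && ([set x; y] != e)].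

(* In a tree, deleting an edge leaves exactly two components, so the one not
   containing v consists of all the nodes that v no longer reaches. *)
Definition far_component (e : {set V}) (v : V) : {set V} :=
  [set x | ~~ connect (delete_edge e) v x].

End Trees.

Section Widths.
Variables (F : finFieldType) (I : finType) (C : {vspace {ffun I -> F^o}}).

(* Integer-valued, to avoid truncated subtraction. *)
Definition node_width (V : finType) (E : rel V) (w : I -> V) (v : V) : int :=
  (\dim C)%:Z - \sum_(e in incident_edges E v)
    (\dim (shortening C (w @^-1: far_component E e v)))%:Z.

Definition is_width (V : finType) (E : rel V) (w : I -> V) (m : int) : Prop :=
  is_greatest (fun x => exists v, node_width E w v = x) m.

Definition is_treewidth (m : int) : Prop :=
  is_least (fun x => exists (V : finType) (E : rel V) (w : I -> V),
    is_tree E /\ is_width E w x) m.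

Definition path_graph (n : nat) : rel 'I_n :=
  [rel i j : 'I_n | (i.+1 == j :> nat) || (j.+1 == i :> nat)].

Definition is_trelliswidth (m : int) : Prop :=
  is_least (fun x => exists p : I -> 'I_#|I|,
    bijective p /\ is_width (@path_graph #|I|) p x) m.

End Widths.

(* Main.v *)
(* A codeword of an MDS code supported on at most n - k coordinates vanishes, so
   dim C_J = max(0, |J| - (n - k)).  Call a side of a tree edge heavy if it
   carries more than n - k coordinates.  If no side is heavy, every node has
   width k.  Otherwise take an edge vu whose u-side is heavy with as few nodes as
   possible: at u no edge other than uv has a heavy far side, and the far side of
   uv carries at most k - 1 coordinates, so u has width at least
   min(k, n - k + 1).  Conversely, on the path with one coordinate per node the
   two shortenings at a node have dimensions summing to at least
   (n - 1) - 2(n - k), so no node has width above min(k, n - k + 1). *)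
Require Import Defs.
From HB Require Import structures.
From mathcomp Require Import all_boot all_order all_algebra.
From mathcomp Require Import zify.

Set Implicit Arguments.
Unset Strict Implicit.
Unset Printing Implicit Defensive.

Import Order.TTheory GRing.Theory Num.Theory.
Local Open Scope ring_scope.

(** * Dimensions of the shortenings of an MDS code *)

Lemma subset_of_card (T : finType) (A : {set T}) (m : nat) :
  exists B : {set T}, B \subset A /\ #|B| = minn m #|A|.
Proof.
exists [set x in take m (enum A)]; split.
  by apply/subsetP => x; rewrite inE => /mem_take; rewrite mem_enum.
rewrite cardsE (card_uniqP _) ?take_uniq ?enum_uniq //.
by rewrite size_take_min -cardE.
Qed.

Section CodeDimension.
Variables (F : finFieldType) (I : finType).
Implicit Types (C : {vspace {ffun I -> F^o}}) (J K : {set I}).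

Lemma dim_ffun_set J :
  \dim {: {ffun {i : I | i \in J} -> F^o}} = #|J|.
Proof. by rewrite dimvf /= /dim /= muln1 card_sig; apply: eq_card => i. Qed.

Lemma dim_ffun_full : \dim {: {ffun I -> F^o}} = #|I|.
Proof. by rewrite dimvf /= /dim /= muln1. Qed.

Lemma lker_restrP J (x : {ffun I -> F^o}) :
  reflect (forall i, i \in J -> x i = 0) (x \in lker (linfun (restr J))).
Proof.
rewrite memv_ker lfunE; apply: (iffP eqP) => [/ffunP x0 i iJ | x0].
  by have := x0 (exist _ i iJ); rewrite !ffunE.
by apply/ffunP => i; rewrite !ffunE; apply: x0; apply: valP.
Qed.

Lemma dim_le_card C K :
  (forall x, x \in C -> (forall i, i \in K -> x i = 0) -> x = 0) ->
  (\dim C <= #|K|)%N.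
Proof.
move=> inj; rewrite -(dim_ffun_set K).
rewrite -(@limg_dim_eq _ _ _ (linfun (restr K))) ?dimvS ?subvf //.
apply/eqP; rewrite -subv0; apply/subvP => x.
by rewrite memv_cap memv0 => /andP[xC /lker_restrP x0]; apply/eqP/inj.
Qed.

(** A word vanishing both off and on [J] is zero, so restriction to [J] is injective on the subcode
    supported in [J]. *)
Lemma dim_shortening_cap C J :
  \dim (shortening C J) = \dim (C :&: lker (linfun (restr (~: J)))).
Proof.
rewrite limg_dim_eq //; apply/eqP; rewrite -subv0; apply/subvP => x.
rewrite !memv_cap memv0 => /andP[/andP[_ /lker_restrP x0] /lker_restrP x0'].
apply/eqP/ffunP => i; rewrite ffunE; have [/x0' // | iJ] := boolP (i \in J).
by apply: x0; rewrite inE.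
Qed.

Lemma MDS_word_eq0 C K (x : {ffun I -> F^o}) :
  is_MDS C -> (#|K| <= #|I| - \dim C)%N -> x \in C ->
  (forall i, i \notin K -> x i = 0) -> x = 0.
Proof.
move=> [_ [_ dmin]] leK xC x0; apply/eqP; apply: contraT => x_neq0.
have le_dist : (hamming_dist x 0%R <= #|K|)%N.
  apply/subset_leq_card/subsetP => i; rewrite inE ffunE.
  by apply: contraR => /x0 ->.
have /dmin : exists y z, [/\ y \in C, z \in C, y != z
                           & hamming_dist y z = hamming_dist x 0%R].
  by exists x, 0; rewrite mem0v.
by rewrite leEnat; lia.
Qed.

(** Truncated subtraction plays the role of the maximum with 0. For the upper bound, a word
    supported in [J] is determined by its values off a set [K] of at most n - k coordinates of [J].
    For the lower bound, apply rank-nullity to the restriction to the complement of [J]. *)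
Lemma dim_shortening C J :
  is_MDS C -> \dim (shortening C J) = (#|J| - (#|I| - \dim C))%N.
Proof.
move=> mdsC; rewrite dim_shortening_cap; set D := (_ :&: _)%VS.
have leC : (\dim C <= #|I|)%N by rewrite -dim_ffun_full dimvS ?subvf.
apply/eqP; rewrite eqn_leq; apply/andP; split.
  have [K [sKJ cardK]] := subset_of_card J (#|I| - \dim C).
  have -> : (#|J| - (#|I| - \dim C))%N = #|J :\: K|.
    by rewrite cardsD (setIidPr sKJ) cardK; lia.
  apply: dim_le_card => x; rewrite memv_cap => /andP[xC /lker_restrP xJ] xK.
  apply: (MDS_word_eq0 (K := K) mdsC) => // [|i iK]; first by lia.
  have [iJ | iJ] := boolP (i \in J); first by rewrite xK // inE iK.
  by rewrite xJ // inE.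
have : (\dim D + \dim (linfun (restr (~: J)) @: C) = \dim C)%N.
  exact: limg_ker_dim.
have : (\dim (linfun (restr (~: J)) @: C) <= #|~: J|)%N.
  by rewrite -dim_ffun_set dimvS ?subvf.
have := cardsC J; lia.
Qed.

End CodeDimension.

(** * Far components of tree edges *)

Lemma connect_invariant (T : finType) (e : rel T) (P : pred T) (x y : T) :
  P x -> (forall z z', connect e x z -> P z -> e z z' -> P z') ->
  connect e x y -> P y.
Proof.
move=> Px step /connectP[p]; elim/last_ind: p y => [|p z IHp] y; first by move=> _ ->.
rewrite rcons_path last_rcons => /andP[pp ez] ->.
by apply: step ez; [apply/connectP; exists p | apply: IHp pp _].
Qed.

Section TreeLemmas.
Variables (V : finType) (E : rel V).

Lemma delete_edgeE (e : {set V}) x y :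
  delete_edge E e x y = E x y && ([set x; y] != e).
Proof. by []. Qed.

Lemma sum_incident_edges (v : V) (f : {set V} -> int) : irreflexive E ->
  \sum_(e in incident_edges E v) f e = \sum_(u | E v u) f [set v; u].
Proof.
move=> irrE; rewrite /incident_edges big_imset /=.
  by apply: eq_bigl => u; rewrite inE.
move=> u u'; rewrite !inE => Evu Evu' /setP/(_ u).
rewrite !inE eqxx orbT; case: eqP => [uv | _ /esym/eqP //].
by rewrite uv irrE in Evu.
Qed.

Hypothesis treeE : is_tree E.

(** A simple path from [v] to [u] avoiding the edge [vu] would close up with it into a cycle. *)
Lemma tree_edge_cut v u : E v u -> ~~ connect (delete_edge E [set v; u]) v u.
Proof.
have [symE irrE _ _ acyE] := treeE; move=> Evu; apply/negP => /connectP[p].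
case/shortenP => p' pp' up' _ lastp.
apply: (acyE (v :: p')).
  (* The cycle has at least three nodes: an empty path would make [vu] a loop, and a one-step path
     would be the deleted edge. *)
  case: p' pp' lastp {up'} => [|a [|b s]] //=.
    by move=> _ uv; rewrite uv irrE in Evu.
  by rewrite andbT => /andP[_ /eqP neq] uE; rewrite uE in neq.
apply/andP; split=> //=; rewrite rcons_path -lastp symE Evu andbT.
by apply: sub_path pp' => x y /= /andP[].
Qed.

(** Follow a walk in the tree from [v]: each node remains joined to [v] or [u] after the deletion,
    since crossing the deleted edge lands on one of its ends. *)
Lemma far_component_disjoint v u :
  [disjoint far_component E [set v; u] v & far_component E [set v; u] u].
Proof.
have [_ _ _ conE _] := treeE.
rewrite disjoints_subset; apply/subsetP => x; rewrite !inE negbK.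
pose e := delete_edge E [set v; u].
suff /orP[-> // | //] : connect e v x || connect e u x.
apply: (connect_invariant (e := E) (x := v)
  (P := fun x => connect e v x || connect e u x)) (conE v x).
  by rewrite connect0.
move=> z z' _ Pz Ezz'; have [ezz' | ezz'] := boolP (e z z').
  by case/orP: Pz => Pz; rewrite (connect_trans Pz (connect1 ezz')) ?orbT.
move: ezz'; rewrite /e delete_edgeE Ezz' negbK => /eqP/setP/(_ z').
by rewrite !inE eqxx orbT => /esym/orP[]/eqP->; rewrite connect0 ?orbT.
Qed.

(** A walk from [v] avoiding [vu] never meets [u], hence never uses [ux]; preceded by the edge [uv],
    it stays a walk from [u] after [ux] is deleted. The node [u] makes the inclusion strict. *)
Lemma far_component_proper v u x : E v u -> E u x -> x != v ->
  far_component E [set u; x] u \proper far_component E [set v; u] v.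
Proof.
have [symE irrE _ _ _] := treeE; move=> Evu Eux neq_xv.
have cut := tree_edge_cut Evu.
apply/properP; split; last by exists u; rewrite !inE ?connect0 // negbK.
apply/subsetP => y; rewrite !inE; apply: contra.
have uv : connect (delete_edge E [set u; x]) u v.
  apply: connect1; rewrite delete_edgeE symE Evu; apply/eqP => /setP/(_ v).
  rewrite !inE eqxx orbT eq_sym [v == x]eq_sym (negPf neq_xv) orbF => /esym/eqP uv.
  by rewrite uv irrE in Evu.
apply: connect_invariant => // z z' cz uz ezz'.
apply: connect_trans uz _; apply: connect1; rewrite delete_edgeE.
have cz' := connect_trans cz (connect1 ezz').
case/andP: (ezz') => -> _ /=; apply/eqP => /setP/(_ u).
by rewrite !inE eqxx /= => /orP[]/eqP uE; case/negP: cut; rewrite {2}uE.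
Qed.

End TreeLemmas.

(** * Lower bound for all tree decompositions *)

Lemma tree_width_ge (F : finFieldType) (I : finType)
    (C : {vspace {ffun I -> F^o}}) (V : finType) (E : rel V) (w : I -> V) :
  is_MDS C -> is_tree E ->
  exists v, (minn (\dim C) (#|I| - \dim C + 1))%N%:Z <= node_width C E w v.
Proof.
move=> mdsC treeE; have [symE irrE /card_gt0P[v0 _] _ _] := treeE.
have leC : (\dim C <= #|I|)%N by rewrite -(dim_ffun_full F I) dimvS ?subvf.
set r := (#|I| - \dim C)%N.
(* The ordered pair (v, u) stands for the edge [vu] seen from [v]; its side is the one containing
   [u]. *)
pose side (p : V * V) := far_component E [set p.1; p.2] p.1.
pose heavy p := E p.1 p.2 && (r < #|w @^-1: side p|)%N.
have light u x : E u x -> ~~ heavy (u, x) ->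
    (\dim (shortening C (w @^-1: far_component E [set u; x] u)))%:Z = 0.
  rewrite /heavy /= dim_shortening // => ->; rewrite -leqNgt => le_r.
  by apply/eqP; rewrite eqz_nat subn_eq0.
have [p0 heavy0 | noheavy] := pickP heavy; last first.
  exists v0; rewrite /node_width sum_incident_edges //.
  by rewrite big1 => [|u Eu]; [rewrite subr0 lez_nat geq_minl | apply: light => //; rewrite noheavy].
case: (arg_minnP (fun p => #|side p|) heavy0) => -[v u] /andP[/= Evu gt_r] minp.
exists u; rewrite /node_width sum_incident_edges // (bigD1 v) 1?symE //=.
rewrite big1 => [|x /andP[Eux neq_xv]]; last first.
  (* A heavy pair (u, x) with [x] other than [v] would have a strictly smaller side than (v, u),
     against minimality. *)
  apply: light => //; apply/negP => /minp; rewrite leqNgt => /negP; apply.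
  exact/proper_card/far_component_proper.
rewrite dim_shortening // -/r.
(* The two sides of [uv] share no coordinate, which leaves at most k - 1 for the side of [v]; its
   shortening has dimension at most max(0, 2k - n - 1). *)
have : (#|w @^-1: far_component E [set u; v] u|
        + #|w @^-1: side (v, u)| <= #|I|)%N.
  have := far_component_disjoint treeE u v.
  move=> dis; rewrite -cardsUI /side /= [[set v; u]]setUC.
  suff -> : w @^-1: far_component E [set u; v] u
            :&: w @^-1: far_component E [set u; v] v = set0.
    by rewrite cards0 addn0 max_card.
  rewrite -preimsetI; move: dis; rewrite -setI_eq0 => /eqP ->.
  by rewrite preimset0.
move: gt_r; rewrite /r; lia.
Qed.

(** * The path graph and its far components *)

Section Path.
Variable n : nat.
Local Notation P := (@path_graph n).

Lemma path_graphE i j : P i j = (i.+1 == j :> nat) || (j.+1 == i :> nat).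
Proof. by []. Qed.

Lemma path_graph_sym : symmetric P.
Proof. by move=> i j; rewrite !path_graphE orbC. Qed.

Lemma path_graph_irr : irreflexive P.
Proof. by move=> i; rewrite path_graphE; lia. Qed.

Lemma path_graph_connect x y : connect P x y.
Proof.
have symP := sym_connect_sym path_graph_sym.
have n_gt0 : (0 < n)%N := leq_ltn_trans (leq0n x) (ltn_ord x).
suff from0 z : connect P (Ordinal n_gt0) z.
  by apply: connect_trans (from0 y); rewrite symP.
case: z => m; elim: m => [|m IHm] ltm.
  by apply: eq_connect0; apply: val_inj.
apply: connect_trans (IHm (ltnW ltm)) _.
by apply: connect1; rewrite path_graphE eqxx.
Qed.

(* Both cyclic neighbours of the largest node of a cycle are its predecessor. *)
Lemma path_graph_acyclic (c : seq 'I_n) : (2 < size c)%N -> ~ ucycle P c.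
Proof.
move=> size_c cyc.
have [x0 x0c] : exists x0, x0 \in c.
  by case: c size_c {cyc} => [|x s] //; exists x; rewrite mem_head.
case: (@arg_maxnP _ x0 (mem c) val x0c) => x xc maxx.
have [i s rot_c] := rot_to xc.
have maxs y : y \in s -> (y <= x)%N.
  by move=> ys; apply: maxx; rewrite /= -(mem_rot i) rot_c inE ys orbT.
move: cyc size_c; rewrite -(rot_ucycle i) -(size_rot i) rot_c.
case: s {rot_c} maxs => [|y [|z s]] // maxs /andP[cyc uniqc] _.
have eq_y : y = last z s.
  have := maxs y (mem_head _ _).
  have := maxs (last z s); rewrite inE mem_last orbT => /(_ isT).
  move: cyc; rewrite (cycle_path x) /= !path_graphE => /and3P[].
  by move=> *; apply: val_inj => /=; lia.
by move: uniqc; rewrite /= eq_y mem_last /= andbF.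
Qed.

Lemma path_graph_tree : (0 < n)%N -> is_tree P.
Proof.
move=> n_gt0; split; first exact: path_graph_sym.
- exact: path_graph_irr.
- by rewrite card_ord.
- exact: path_graph_connect.
- exact: path_graph_acyclic.
Qed.

Lemma card_ord_lt m : (m <= n)%N -> #|[set x : 'I_n | (x < m)%N]| = m.
Proof.
move=> le_mn; rewrite -sum1_card -[RHS]card_ord -sum1_card.
by rewrite (big_ord_widen n (fun=> 1%N)) //; apply: eq_bigl => x; rewrite inE.
Qed.

Lemma card_ord_gt (v : 'I_n) : #|[set x : 'I_n | (v < x)%N]| = (n - v.+1)%N.
Proof.
have -> : [set x : 'I_n | (v < x)%N] = ~: [set x : 'I_n | (x < v.+1)%N].
  by apply/setP => x; rewrite !inE -leqNgt.
by rewrite cardsCs setCK card_ord card_ord_lt.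
Qed.

(** Without the edge from [v] to its successor, a walk from [v] cannot climb above [v]. This
    inclusion suffices, as it serves to bound dimensions of shortenings from below. *)
Lemma path_far_right (v u : 'I_n) : v.+1 = u ->
  [set x : 'I_n | (v < x)%N] \subset far_component P [set v; u] v.
Proof.
move=> vu; apply/subsetP => x; rewrite !inE ltnNge; apply: contra.
apply: (connect_invariant (P := fun z : 'I_n => (z <= v)%N)) => //.
move=> z z' _ le_zv /andP[]; rewrite path_graphE => Pzz' neq.
rewrite leqNgt; apply/negP => gt_z'v; case/eqP: neq.
have -> : z = v by apply: val_inj => /=; lia.
by have -> : z' = u by apply: val_inj => /=; lia.
Qed.

Lemma path_far_left (v u : 'I_n) : u.+1 = v ->
  [set x : 'I_n | (x < v)%N] \subset far_component P [set v; u] v.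
Proof.
move=> uv; apply/subsetP => x; rewrite !inE ltnNge; apply: contra.
apply: (connect_invariant (P := fun z : 'I_n => (v <= z)%N)) => //.
move=> z z' _ le_vz /andP[]; rewrite path_graphE => Pzz' neq.
rewrite leqNgt; apply/negP => lt_z'v; case/eqP: neq.
have -> : z = v by apply: val_inj => /=; lia.
by have -> : z' = u by apply: val_inj => /=; lia.
Qed.

End Path.

(** * Upper bound on the path, and both minima *)

Lemma path_width_le (F : finFieldType) (I : finType)
    (C : {vspace {ffun I -> F^o}}) (n : nat) (p : I -> 'I_n) (v : 'I_n) :
  is_MDS C -> bijective p ->
  node_width C (@path_graph n) p v
    <= (minn (\dim C) (#|I| - \dim C + 1))%N%:Z.
Proof.
move=> mdsC bij_p; rewrite /node_width.
have card_I : #|I| = n by rewrite (bij_eq_card bij_p) card_ord.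
have leC : (\dim C <= #|I|)%N by rewrite -(dim_ffun_full F I) dimvS ?subvf.
have C_gt0 : (0 < \dim C)%N.
  by case: mdsC => C0 _; rewrite lt0n dimv_eq0.
rewrite sum_incident_edges; last exact: path_graph_irr.
pose f u : int :=
  (\dim (shortening C (p @^-1: far_component (@path_graph n) [set v; u] v)))%:Z.
rewrite -/(\sum_(u | path_graph v u) f u).
have f_ge0 u : 0 <= f u by rewrite /f.
have dim_ge (A : {set 'I_n}) u :
    A \subset far_component (@path_graph n) [set v; u] v ->
    #|A|%:Z - (#|I| - \dim C)%N%:Z <= f u.
  move=> sA; rewrite /f dim_shortening //.
  have := subset_leq_card (preimsetS p sA).
  have -> : #|p @^-1: A| = #|A| by apply/on_card_preimset/onW_bij.
  by move: (#|_ @^-1: _|) #|A| => b a; lia.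
have sum_ge0 (Q : pred 'I_n) : 0 <= \sum_(u | Q u) f u by apply: sumr_ge0.
(* Summing over all successors of [v] covers the end node too: there the sum is empty and the
   left-hand side is at most 0. *)
have right_ge : (n - v.+1)%N%:Z - (#|I| - \dim C)%N%:Z
    <= \sum_(u : 'I_n | v.+1 == u) f u.
  have [lt_vn | ge_vn] := ltnP v.+1 n; last first.
    by apply: le_trans (sum_ge0 _); lia.
  rewrite (big_pred1 (Ordinal lt_vn)) => [|u]; last by rewrite eq_sym.
  by rewrite -card_ord_gt dim_ge // path_far_right.
have left_ge : v%:Z - (#|I| - \dim C)%N%:Z
    <= \sum_(u : 'I_n | u.+1 == v) f u.
  have [v0 | v_gt0] := posnP v.
    by apply: le_trans (sum_ge0 _); lia.
  have lt_vn : (v.-1 < n)%N by have := ltn_ord v; lia.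
  rewrite (big_pred1 (Ordinal lt_vn)) => [|u]; last first.
    apply/eqP/eqP => [uv | -> /=]; last exact: prednK.
    by apply: val_inj; rewrite /= -uv.
  by rewrite -{1}(card_ord_lt (ltnW (ltn_ord v))) dim_ge // path_far_left //= prednK.
have split_sum : \sum_(u | path_graph v u) f u =
    \sum_(u : 'I_n | v.+1 == u) f u + \sum_(u : 'I_n | u.+1 == v) f u.
  rewrite (bigID (fun u : 'I_n => v.+1 == u)) /=.
  by congr (_ + _); apply: eq_bigl => u; rewrite path_graphE; lia.
(* Nonnegativity of the sum gives the bound k; the two one-sided estimates give n - k + 1. *)
have := sum_ge0 (path_graph v); rewrite split_sum.
have := ltn_ord v; lia.
Qed.

(** The lower bound for trees, applied to the path, yields a node attaining the upper bound. *)
Lemma path_is_width (F : finFieldType) (I : finType)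
    (C : {vspace {ffun I -> F^o}}) (n : nat) (p : I -> 'I_n) :
  (0 < n)%N -> is_MDS C -> bijective p ->
  is_width C (@path_graph n) p (minn (\dim C) (#|I| - \dim C + 1))%N%:Z.
Proof.
move=> n_gt0 mdsC bij_p; split=> [|_ [v <-]]; last exact: path_width_le.
have [v ge_v] := tree_width_ge p mdsC (path_graph_tree n_gt0).
by exists v; apply: le_anti; rewrite ge_v path_width_le.
Qed.

Lemma tree_is_width_ge (F : finFieldType) (I : finType)
    (C : {vspace {ffun I -> F^o}}) (V : finType) (E : rel V) (w : I -> V) x :
  is_MDS C -> is_tree E -> is_width C E w x ->
  (minn (\dim C) (#|I| - \dim C + 1))%N%:Z <= x.
Proof.
move=> mdsC treeE [_ maxx]; have [v ge_v] := tree_width_ge w mdsC treeE.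
by apply: le_trans ge_v _; apply: maxx; exists v.
Qed.

Theorem theorem5 (F : finFieldType) (I : finType)
    (C : {vspace {ffun I -> F^o}}) (n k : nat)
    (hn : #|I| = n) (hk : \dim C = k) (hC : is_MDS C) :
  is_treewidth C (minn k (n - k + 1))%N%:Z /\
  is_trelliswidth C (minn k (n - k + 1))%N%:Z.
Proof.
subst n k.
have I_gt0 : (0 < #|I|)%N.
  have [C0 _] := hC; rewrite -(dim_ffun_full F I).
  by apply: leq_trans (dimvS (subvf C)); rewrite lt0n dimv_eq0.
(* Any bijection onto the path attains both minima; [enum_rank] is one. *)
have width_path := path_is_width I_gt0 hC (enum_rank_bij I).
have tree_path := path_graph_tree I_gt0.
split; split.
- by exists 'I_#|I|, (@path_graph #|I|), enum_rank.
- by move=> x [V [E [w [treeE]]]]; apply: tree_is_width_ge.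
- by exists enum_rank; split; first exact: enum_rank_bij.
- by move=> x [p [_]]; apply: tree_is_width_ge.
Qed.
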